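(* The sequence $\{\beta_n(q)\}_{n\ge0}$ satisfies the homogeneous second-order recurrence $$\beta_0(q)=0,\quad \beta_1(q)=q,\quad \beta_n(q)=d_n(q)\,\beta_{n-1}(q)+c_n(q)\,\beta_{n-2}(q)\quad\text{for all } n\ge2,$$ where $d_n(q)=1+q-q^n$ and $c_n(q)=q^{2n-1}+q^n-q$.
   Context: The polynomials $\alpha_n(q)=\widehat F^{(n)}_0(q)$ and $\beta_n(q)=\widehat F^{(n)}_1(q)$ ($n\ge0$) are defined by $\alpha_0=1$, $\beta_0=0$ and, for $n\ge1$, $$\alpha_n=\alpha_{n-1}+q^n\beta_{n-1},\qquad \beta_n=q^n\alpha_{n-1}+(1-q^n)\beta_{n-1}.$$ *)

(* Defs.v *)
From mathcomp Require Import all_boot all_order all_algebra.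

Set Implicit Arguments.
Unset Strict Implicit.
Unset Printing Implicit Defensive.

Import GRing.Theory.
Local Open Scope ring_scope.

(* The indeterminate q is 'X in {poly int}. In the successor branches the
   index is m.+1, so the weight q^n reads 'X^(m.+1). *)
Fixpoint alpha (n : nat) : {poly int} :=
  match n with
  | 0 => 1
  | m.+1 => alpha m + 'X^(m.+1) * beta m
  end
with beta (n : nat) : {poly int} :=
  match n with
  | 0 => 0
  | m.+1 => 'X^(m.+1) * alpha m + (1 - 'X^(m.+1)) * beta m
  end.

Definition d (n : nat) : {poly int} := 1 + 'X - 'X^n.

(* The exponent uses truncated subtraction, which is exact for n >= 1. *)
Definition c (n : nat) : {poly int} := 'X^(2 * n - 1) + 'X^n - 'X.

(* Main.v *)
Require Import Defs.
From mathcomp Require Import all_boot all_order all_algebra.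
From mathcomp Require Import ring.
Import GRing.Theory.
Local Open Scope ring_scope.

(** Eliminate [alpha]: in [beta n] it enters as q^n alpha_{n-1} = q (q^(n-1) alpha_{n-2} + q^(2n-2)
    beta_{n-2}), and the previous [beta] step expresses q^(n-1) alpha_{n-2} through beta_{n-1} and
    beta_{n-2}. *)

Lemma alphaS (n : nat) : alpha n.+1 = alpha n + 'X^(n.+1) * beta n.
Proof. by []. Qed.

Lemma betaS (n : nat) :
  beta n.+1 = 'X^(n.+1) * alpha n + (1 - 'X^(n.+1)) * beta n.
Proof. by []. Qed.

Theorem proposition3 :
  [/\ beta 0 = 0,
      beta 1 = 'X
    & forall n : nat, (2 <= n)%N ->
        beta n = d n * beta (n - 1)%N + c n * beta (n - 2)%N].
Proof.
split=> //; first by rewrite betaS mulr0 addr0 mulr1 expr1.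
case=> [|[|m]] // _.
have c_exp : (2 * m.+2 - 1 = (m.+1 + m.+1).+1)%N.
  by rewrite mul2n -addnn addSn addnS subn1.
rewrite !subSS !subn0 /d /c c_exp (betaS m.+1) alphaS (betaS m).
rewrite (exprS _ m.+1) (exprS _ (m.+1 + m.+1)) exprD.
move: 'X^(m.+1) (alpha m) (beta m) => Q a b.
ring.
Qed.
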